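(* Let $(x_n)_{n\ge 0}$ be the sequence of positive integers defined by $x_0=x_1=1$ and $x_{n+2}x_n=x_{n+1}^2(x_n+1)$ for $n\ge 0$. Then $$\left[1;1,x_1,1,x_2,1,x_3,1,x_4,\ldots,1,x_k,\ldots\right]=\sum_{n=1}^{\infty}\frac{1}{x_n}.$$
   Context: $[c_0;c_1,c_2,\ldots]$ denotes the regular continued fraction $c_0+\cfrac{1}{c_1+\cfrac{1}{c_2+\cdots}}$. Here $c_0=1$ and, for $k\ge 1$, $c_{2k-1}=1$ and $c_{2k}=x_k$. *)

(* Defs.v *)
(* Stdlib reals with Coquelicot. *)
From Stdlib Require Import Reals ZArith Arith Lia.
From Coquelicot Require Import Coquelicot.

(* [contfrac_fin c n] is the finite continued fraction
   [c_0; c_1, ..., c_n] = c_0 + 1/(c_1 + 1/(... + 1/c_n)). *)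
Fixpoint contfrac_fin (c : nat -> Z) (n : nat) : R :=
  match n with
  | O => IZR (c O)
  | S m => (IZR (c O) + 1 / contfrac_fin (fun k => c (S k)) m)%R
  end.

(* The infinite continued fraction [c_0; c_1, c_2, ...] converges and has
   value [l]: it is the limit of its finite truncations. *)
Definition is_contfrac (c : nat -> Z) (l : R) : Prop :=
  is_lim_seq (contfrac_fin c) (Finite l).

(* The sequence 1; 1, x_1, 1, x_2, 1, x_3, ... *)
Definition interleave_ones (x : nat -> Z) (k : nat) : Z :=
  match k with
  | O => 1%Z
  | S _ => if Nat.odd k then 1%Z else x (Nat.div2 k)
  end.

Record is_xseq (x : nat -> Z) : Prop := {
  xseq_pos : forall n : nat, (0 < x n)%Z;
  xseq_0 : x 0%nat = 1%Z;
  xseq_1 : x 1%nat = 1%Z;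
  xseq_rec : forall n : nat,
    (x (n + 2)%nat * x n = x (n + 1)%nat ^ 2 * (x n + 1))%Z
}.

(* The recurrence does determine a sequence of positive integers: the pair
   (x_n, x_{n+1} / x_n) evolves by (a, q) |-> (a q, q (a + 1)). *)
Fixpoint xseq_pair (n : nat) : Z * Z :=
  match n with
  | O => (1, 1)%Z
  | S m => let (a, q) := xseq_pair m in (a * q, q * (a + 1))%Z
  end.

Lemma is_xseq_exists_unique :
  exists x, is_xseq x /\ forall y, is_xseq y -> forall n, y n = x n.
Proof.
assert (E : is_xseq (fun n => fst (xseq_pair n))).
{ split; try reflexivity.
  - intro n.
    enough (0 < fst (xseq_pair n) /\ 0 < snd (xseq_pair n))%Z by tauto.
    induction n as [|n IH]; simpl; [lia|].
    destruct (xseq_pair n) as [a q]; simpl in *; nia.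
  - intro n.
    rewrite (Nat.add_comm n 2), (Nat.add_comm n 1); simpl Nat.add.
    simpl xseq_pair; destruct (xseq_pair n) as [a q]; simpl fst; ring. }
eexists; split; [exact E|]; intros y Hy.
enough (H : forall n, y n = fst (xseq_pair n)
                   /\ y (S n) = fst (xseq_pair (S n))) by (intro n; apply H).
induction n as [|n [IH1 IH2]].
- split; [apply (xseq_0 _ Hy)|apply (xseq_1 _ Hy)].
- split; [exact IH2|].
  pose proof (xseq_rec _ Hy n) as R1; pose proof (xseq_rec _ E n) as R2.
  pose proof (xseq_pos _ Hy n) as P; cbv beta in R2.
  rewrite (Nat.add_comm n 2), (Nat.add_comm n 1) in R1, R2.
  change (2 + n)%nat with (S (S n)) in *; change (1 + n)%nat with (S n) in *.
  rewrite <- IH1, <- IH2 in R2; rewrite <- R1 in R2.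
  apply Z.mul_reg_r with (y n); lia.
Qed.

(* Main.v *)
Require Import Defs.
From Stdlib Require Import Reals ZArith Arith Lia Lra.
From Coquelicot Require Import Coquelicot.

(** Let p_n / q_n be the convergents of the continued fraction. The recurrence
    makes r_k = x_(k+1) / x_k satisfy r_(k+1) = r_k + x_(k+1), and
    induction gives q_(2k) = x_(k+1) and q_(2k+1) = r_(k+1) - 1. Consecutive
    even convergents therefore differ by
    c_(2k+2) / (q_(2k) q_(2k+2)) = 1 / x_(k+2), so that p_(2k) / q_(2k) is the
    partial sum 1/x_1 + ... + 1/x_(k+1); the following odd convergent exceeds
    it by 1 / (q_(2k) q_(2k+1)) <= 1 / x_(k+1), which tends to 0. *)

(** Indices are shifted by one: [conv_num c (S n) / conv_den c (S n)] is
    [c_0; c_1, ..., c_n], and index 0 is the formal convergent 1/0. *)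
Fixpoint conv_num (c : nat -> Z) (n : nat) : Z :=
  match n with
  | O => 1
  | S m => match m with
           | O => c O
           | S l => c m * conv_num c m + conv_num c l
           end
  end.

Fixpoint conv_den (c : nat -> Z) (n : nat) : Z :=
  match n with
  | O => 0
  | S m => match m with
           | O => 1
           | S l => c m * conv_den c m + conv_den c l
           end
  end.

Lemma conv_num_rec (c : nat -> Z) (n : nat) :
  conv_num c (S (S n)) = (c (S n) * conv_num c (S n) + conv_num c n)%Z.
Proof. reflexivity. Qed.

Lemma conv_den_rec (c : nat -> Z) (n : nat) :
  conv_den c (S (S n)) = (c (S n) * conv_den c (S n) + conv_den c n)%Z.
Proof. reflexivity. Qed.

Lemma conv_num_pos (c : nat -> Z) (n : nat) :
  (forall k, (0 < c k)%Z) -> (0 < conv_num c n)%Z.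
Proof.
intros Hc.
enough (H : (0 < conv_num c n /\ 0 < conv_num c (S n))%Z) by apply H.
induction n as [|n [IH1 IH2]].
- split; [reflexivity | apply Hc].
- split; [exact IH2|].
  rewrite conv_num_rec; specialize (Hc (S n)); nia.
Qed.

(** Prepending c_0 acts on convergents by the matrix (c_0, 1; 1, 0). This reconciles [contfrac_fin],
    which peels terms off the front, with the recurrences, which append them at the back. *)
Lemma conv_shift (c : nat -> Z) (n : nat) :
  conv_num c (S n) = (c O * conv_num (fun k => c (S k)) n
                      + conv_den (fun k => c (S k)) n)%Z
  /\ conv_den c (S n) = conv_num (fun k => c (S k)) n.
Proof.
set (d := fun k => c (S k)).
(* The recurrences have order two, so the induction carries two consecutive indices. *)
enough (H : (conv_num c (S n) = (c O * conv_num d n + conv_den d n)%Z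
             /\ conv_den c (S n) = conv_num d n)
         /\ (conv_num c (S (S n)) = (c O * conv_num d (S n) + conv_den d (S n))%Z
             /\ conv_den c (S (S n)) = conv_num d (S n))) by apply H.
induction n as [|n [[IH1 IH2] [IH3 IH4]]].
- unfold d; simpl; repeat split; ring.
- split; [now split|].
  rewrite (conv_num_rec c (S n)), (conv_den_rec c (S n)).
  rewrite (conv_num_rec d n), (conv_den_rec d n), IH1, IH2, IH3, IH4.
  change (c (S (S n))) with (d (S n)); split; ring.
Qed.

(** Each denominator is a numerator of the tail of the fraction. The index starts at 1, since the
    formal convergent 1/0 has denominator 0. *)
Lemma conv_den_pos (c : nat -> Z) (n : nat) :
  (forall k, (0 < c k)%Z) -> (0 < conv_den c (S n))%Z.
Proof.
intros Hc; rewrite (proj2 (conv_shift c n)).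
now apply conv_num_pos; intro k; apply Hc.
Qed.

Lemma contfrac_fin_conv (c : nat -> Z) (n : nat) :
  (forall k, (0 < c k)%Z) ->
  contfrac_fin c n = (IZR (conv_num c (S n)) / IZR (conv_den c (S n)))%R.
Proof.
revert c; induction n as [|n IH]; intros c Hc; [simpl; field|].
destruct (conv_shift c (S n)) as [-> ->].
assert (Hd : forall k, (0 < c (S k))%Z) by (intro k; apply Hc).
simpl contfrac_fin; rewrite (IH _ Hd).
pose proof (IZR_lt _ _ (conv_num_pos _ (S n) Hd)).
pose proof (IZR_lt _ _ (conv_den_pos _ n Hd)).
rewrite plus_IZR, mult_IZR; field; lra.
Qed.

(** The recurrence flips the sign of the determinant at each step; the two parities are stated apart
    to avoid powers of -1. *)
Lemma conv_det (c : nat -> Z) (n : nat) :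
  (conv_num c (S (2 * n)) * conv_den c (2 * n)
   - conv_num c (2 * n) * conv_den c (S (2 * n)) = -1)%Z
  /\ (conv_num c (S (S (2 * n))) * conv_den c (S (2 * n))
      - conv_num c (S (2 * n)) * conv_den c (S (S (2 * n))) = 1)%Z.
Proof.
assert (step : forall m,
  (conv_num c (S (S m)) * conv_den c (S m)
   - conv_num c (S m) * conv_den c (S (S m))
   = - (conv_num c (S m) * conv_den c m - conv_num c m * conv_den c (S m)))%Z).
{ intro m; rewrite conv_num_rec, conv_den_rec; ring. }
induction n as [|n [IH1 IH2]].
- split; [|rewrite step]; simpl; ring.
- replace (2 * S n)%nat with (S (S (2 * n))) by lia.
  rewrite !step in *; lia.
Qed.

Lemma interleave_ones_pos (x : nat -> Z) :
  (forall n, (0 < x n)%Z) -> forall k, (0 < interleave_ones x k)%Z.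
Proof.
intros Hx [|k]; [reflexivity|].
unfold interleave_ones; destruct (Nat.odd (S k)); [reflexivity|apply Hx].
Qed.

Lemma interleave_ones_odd (x : nat -> Z) (k : nat) :
  interleave_ones x (S (2 * k)) = 1%Z.
Proof.
unfold interleave_ones; now rewrite Nat.odd_succ, Nat.even_even.
Qed.

Lemma interleave_ones_even (x : nat -> Z) (k : nat) :
  interleave_ones x (S (S (2 * k))) = x (S k).
Proof.
unfold interleave_ones; replace (S (S (2 * k))) with (2 * S k)%nat by lia.
now rewrite Nat.odd_even, Nat.div2_double.
Qed.

Lemma xseq_rec_S (x : nat -> Z) (n : nat) : is_xseq x ->
  (x (S (S n)) * x n = x (S n) * x (S n) * (x n + 1))%Z.
Proof.
intros hx; pose proof (xseq_rec _ hx n) as H.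
rewrite (Nat.add_comm n 2), (Nat.add_comm n 1), Z.pow_2_r in H; exact H.
Qed.

(** The second conjunct is q_(2k+1) + 1 = r_(k+1), written without division. *)
Lemma conv_den_xseq (x : nat -> Z) (k : nat) : is_xseq x ->
  conv_den (interleave_ones x) (S (2 * k)) = x (S k)
  /\ (x (S k) * (conv_den (interleave_ones x) (S (S (2 * k))) + 1)
      = x (S (S k)))%Z.
Proof.
intros hx; induction k as [|k [IH1 IH2]].
- pose proof (xseq_rec_S x 0 hx) as H.
  rewrite (xseq_0 _ hx), (xseq_1 _ hx) in H.
  simpl; rewrite (xseq_1 _ hx); lia.
- replace (2 * S k)%nat with (S (S (2 * k))) by lia.
  assert (E : conv_den (interleave_ones x) (S (S (S (2 * k)))) = x (S (S k))).
  { rewrite conv_den_rec, interleave_ones_even, IH1, <- IH2; ring. }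
  split; [exact E|].
  rewrite conv_den_rec, E.
  replace (S (S (S (2 * k)))) with (S (2 * S k)) by lia.
  rewrite interleave_ones_odd.
  pose proof (xseq_pos _ hx (S k)) as P.
  (* The extra factor x_(k+1) lets the recurrence for x apply; what remains is r_(k+2) = r_(k+1) +
     x_(k+2) with denominators cleared. *)
  apply Z.mul_reg_r with (x (S k)); [lia|].
  rewrite (xseq_rec_S x (S k) hx).
  transitivity (x (S (S k)) * (x (S k) * x (S (S k)) + x (S k) *
    (conv_den (interleave_ones x) (S (S (2 * k))) + 1)))%Z; [ring|].
  rewrite IH2; ring.
Qed.

Lemma contfrac_even_xseq (x : nat -> Z) (k : nat) : is_xseq x ->
  contfrac_fin (interleave_ones x) (2 * k)
  = sum_n (fun n => (1 / IZR (x (n + 1)%nat))%R) k.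
Proof.
intros hx.
pose proof (interleave_ones_pos x (xseq_pos _ hx)) as Hc.
rewrite (contfrac_fin_conv _ _ Hc).
induction k as [|k IH].
- rewrite sum_O; simpl; rewrite (xseq_1 _ hx); reflexivity.
- rewrite sum_Sn, <- IH.
  rewrite (proj1 (conv_den_xseq x k hx)), (proj1 (conv_den_xseq x (S k) hx)).
  rewrite (Nat.add_comm (S k) 1); simpl (1 + S k)%nat.
  replace (2 * S k)%nat with (S (S (2 * k))) by lia.
  rewrite (conv_num_rec _ (S (2 * k))), interleave_ones_even.
  destruct (conv_det (interleave_ones x) k) as [_ D].
  destruct (conv_den_xseq x k hx) as [E1 E2].
  rewrite E1 in D.
  set (p := conv_num _ (S (S (2 * k)))) in *.
  set (p' := conv_num _ (S (2 * k))) in *.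
  set (q := conv_den _ (S (S (2 * k)))) in *.
  pose proof (IZR_lt _ _ (xseq_pos _ hx (S k))) as P1.
  pose proof (IZR_lt _ _ (xseq_pos _ hx (S (S k)))) as P2.
  (* This is p_(2k+2) / x_(k+2) = p_(2k) / x_(k+1) + 1 / x_(k+2) with denominators cleared; it
     follows from the determinant [D] and from [E2]. *)
  assert (N : ((x (S k) * p + p') * x (S k) = p' * x (S (S k)) + x (S k))%Z)
    by (transitivity (p' * (x (S k) * (q + 1)) + x (S k) * (p * x (S k) - p' * q))%Z;
        [ring | rewrite D, E2; ring]).
  apply (f_equal IZR) in N; rewrite mult_IZR, !plus_IZR, !mult_IZR in N.
  rewrite plus_IZR, !mult_IZR.
  apply Rmult_eq_reg_r with (IZR (x (S (S k))) * IZR (x (S k)))%R;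
    [|apply Rgt_not_eq, Rmult_lt_0_compat; assumption].
  unfold plus; simpl; field_simplify; [|lra|lra].
  lra.
Qed.

Lemma contfrac_odd_xseq (x : nat -> Z) (k : nat) : is_xseq x ->
  (contfrac_fin (interleave_ones x) (2 * k)
   <= contfrac_fin (interleave_ones x) (S (2 * k))
   <= contfrac_fin (interleave_ones x) (2 * k) + 1 / IZR (x (k + 1)%nat))%R.
Proof.
intros hx; rewrite Nat.add_1_r.
pose proof (interleave_ones_pos x (xseq_pos _ hx)) as Hc.
rewrite !(contfrac_fin_conv _ _ Hc).
destruct (conv_det (interleave_ones x) k) as [_ D].
(* Integrality turns positivity of q_(2k+1) into q_(2k+1) >= 1, which gives the upper bound. *)
pose proof (IZR_le _ _ (proj2 (Z.le_succ_l 0 _)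
  (conv_den_pos _ (S (2 * k)) Hc))) as Q; change (Z.succ 0) with 1%Z in Q.
pose proof (IZR_lt _ _ (xseq_pos _ hx (S k))) as P.
rewrite (proj1 (conv_den_xseq x k hx)) in *.
apply (f_equal IZR) in D; rewrite minus_IZR, !mult_IZR in D.
set (p := IZR (conv_num _ (S (S (2 * k))))) in *.
set (p' := IZR (conv_num _ (S (2 * k)))) in *.
set (q := IZR (conv_den _ (S (S (2 * k))))) in *; set (y := IZR (x (S k))) in *.
assert (E : (p / q = p' / y + 1 / y * / q)%R).
{ apply Rmult_eq_reg_r with (q * y)%R; [field_simplify; lra|].
  apply Rgt_not_eq, Rmult_lt_0_compat; lra. }
assert (0 < 1 / y)%R by (apply Rdiv_lt_0_compat; lra).
assert (0 < / q <= 1)%R.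
{ split; [apply Rinv_0_lt_compat; lra|].
  rewrite <- Rinv_1; apply Rinv_le_contravar; lra. }
rewrite E; nra.
Qed.

(** The ratio x_(n+2) / x_(n+1) equals q_(2n+1) + 1, which is at least 2. *)
Lemma xseq_ge_pow2 (x : nat -> Z) (n : nat) : is_xseq x ->
  (2 ^ n <= IZR (x (S n)))%R.
Proof.
intros hx; induction n as [|n IH].
- rewrite (xseq_1 _ hx); simpl; lra.
- rewrite <- (proj2 (conv_den_xseq x n hx)), mult_IZR, plus_IZR.
  pose proof (interleave_ones_pos x (xseq_pos _ hx)) as Hc.
  pose proof (IZR_le _ _ (proj2 (Z.le_succ_l 0 _)
    (conv_den_pos _ (S (2 * n)) Hc))) as Q; change (Z.succ 0) with 1%Z in Q.
  pose proof (pow_lt 2 n ltac:(lra)); simpl pow; nra.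
Qed.

Lemma ex_series_xseq (x : nat -> Z) : is_xseq x ->
  ex_series (fun n => (1 / IZR (x (n + 1)%nat))%R).
Proof.
intros hx.
apply (ex_series_le (V := R_CompleteNormedModule))
  with (b := fun n => ((/ 2) ^ n)%R).
- intro n; rewrite Nat.add_1_r.
  pose proof (xseq_ge_pow2 x n hx) as H.
  pose proof (pow_lt 2 n ltac:(lra)) as P.
  change (Rabs (1 / IZR (x (S n))) <= (/ 2) ^ n)%R.
  rewrite Rabs_pos_eq.
  + rewrite pow_inv; unfold Rdiv; rewrite Rmult_1_l.
    now apply Rinv_le_contravar.
  + apply Rlt_le, Rdiv_lt_0_compat; lra.
- exists (/ (1 - / 2))%R; apply is_series_geom; rewrite Rabs_pos_eq; lra.
Qed.

(** Transfers limits in k to the truncation index n, which is 2k or 2k+1. *)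
Lemma filterlim_div2 : filterlim Nat.div2 eventually eventually.
Proof.
intros P [N HN]; exists (2 * N)%nat; intros n Hn; apply HN.
rewrite Nat.div2_div; apply Nat.div_le_lower_bound; lia.
Qed.

Theorem mainTheorem6 (x : nat -> Z) (hx : is_xseq x) :
  exists s : R,
    is_contfrac (interleave_ones x) s /\
    is_series (fun n : nat => (1 / IZR (x (n + 1)%nat))%R) s.
Proof.
set (a := fun n : nat => (1 / IZR (x (n + 1)%nat))%R).
destruct (ex_series_xseq x hx) as [s Hs]; exists s; split; [|exact Hs].
assert (HS : is_lim_seq (fun n => sum_n a (Nat.div2 n)) s).
{ apply (is_lim_seq_subseq (sum_n a) s); [exact filterlim_div2|exact Hs]. }
assert (Ha : is_lim_seq (fun n => a (Nat.div2 n)) 0).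
{ apply (is_lim_seq_subseq a 0); [exact filterlim_div2|].
  apply ex_series_lim_0; exists s; exact Hs. }
(* Squeeze: for k = [Nat.div2 n] and either parity of n, the truncation lies between the partial sum
   up to [a k] and that sum plus [a k]. *)
apply is_lim_seq_le_le with (u := fun n => sum_n a (Nat.div2 n))
  (w := fun n => (sum_n a (Nat.div2 n) + a (Nat.div2 n))%R).
- intro n.
  destruct (Nat.Even_or_Odd n) as [[k ->]|[k ->]].
  + rewrite Nat.div2_double, (contfrac_even_xseq x k hx); fold a.
    assert (0 < a k)%R; [|lra].
    apply Rdiv_lt_0_compat; [lra|apply IZR_lt, (xseq_pos _ hx)].
  + rewrite Nat.add_1_r, Nat.div2_succ_double.
    unfold a; rewrite <- (contfrac_even_xseq x k hx).
    now apply contfrac_odd_xseq.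
- exact HS.
- rewrite <- (Rplus_0_r s); now apply is_lim_seq_plus'.
Qed.
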